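(* Let $\rho_i>0$ for all $i\in\{1,\dots,p+1\}$. Then for every $H\in\mathbb R^{N\times(p+1)}$ and every $\overline x=(x^T,-1)^T\in\mathbb R^{p+1}$ (with $x\in\mathbb R^p$), strong duality holds (the optimal values coincide) between the problem $$\max_{\Delta\in\mathbb R^{N\times(p+1)}}\ \|(H+\Delta)\overline x\|^2\quad\text{s.t.}\quad\|\Delta_{:i}\|^2\le\rho_i\quad\forall i\in\{1,\dots,p+1\},$$ and the semidefinite program $$\max_{U,\Delta}\ \operatorname{tr}[U\overline x\,\overline x^T]+\operatorname{tr}[(H^T\Delta+\Delta^TH)\overline x\,\overline x^T]+\operatorname{tr}[H^TH\overline x\,\overline x^T]$$ $$\text{s.t.}\quad U_{ii}=\rho_i\ \ \forall i\in\{1,\dots,p+1\},\qquad\begin{pmatrix}U&\Delta^T\\\Delta&I_N\end{pmatrix}\succeq0,$$ where $U$ ranges over symmetric $(p+1)\times(p+1)$ real matrices and $\Delta$ over $\mathbb R^{N\times(p+1)}$.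
   Context: $\Delta_{:i}$ denotes the $i$th column of $\Delta$, $\|\cdot\|$ is the Euclidean norm, $\operatorname{tr}$ is the trace, $I_N$ is the $N\times N$ identity matrix, and $\succeq0$ means positive semidefinite. *)

(* Defs.v *)
From mathcomp Require Import all_boot all_order all_algebra.
From mathcomp Require Import classical_sets reals.

Set Implicit Arguments.
Unset Strict Implicit.
Unset Printing Implicit Defensive.

Import Order.TTheory GRing.Theory Num.Theory.

Local Open Scope classical_set_scope.
Local Open Scope ring_scope.

(* The norm that MathComp-Analysis puts on matrices is the sup norm, hence a
   separate Euclidean norm. *)
Definition norm2 (R : realType) (n : nat) (v : 'cV[R]_n) : R :=
  Num.sqrt (\sum_(i < n) v i 0 ^+ 2).

Definition psd (R : realType) (n : nat) (A : 'M[R]_n) : Prop :=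
  A \is symmetricmx /\ forall v : 'cV[R]_n, 0 <= (v^T *m A *m v) 0 0.

(* v is the value of "max f(t) s.t. t in F"; the maximum is attained. *)
Definition is_max_value (R : realType) (T : Type) (F : set T) (f : T -> R)
    (v : R) : Prop :=
  (f @` F) v /\ ubound (f @` F) v.

Definition xbar (R : realType) (p : nat) (x : 'cV[R]_p) : 'cV[R]_(p + 1) :=
  col_mx x (const_mx (-1)).

Definition rob_feasible (R : realType) (N p : nat) (rho : 'I_(p + 1) -> R) :
    set 'M[R]_(N, p + 1) :=
  [set Delta | forall i, norm2 (col i Delta) ^+ 2 <= rho i].

Definition rob_objective (R : realType) (N p : nat) (H : 'M[R]_(N, p + 1))
    (x : 'cV[R]_p) (Delta : 'M[R]_(N, p + 1)) : R :=
  norm2 ((H + Delta) *m xbar x) ^+ 2.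

Definition sdp_feasible (R : realType) (N p : nat) (rho : 'I_(p + 1) -> R) :
    set ('M[R]_(p + 1) * 'M[R]_(N, p + 1)) :=
  [set UD | [/\ UD.1 \is symmetricmx,
                forall i, UD.1 i i = rho i
              & psd (block_mx UD.1 UD.2^T UD.2 1%:M)]].

Definition sdp_objective (R : realType) (N p : nat) (H : 'M[R]_(N, p + 1))
    (x : 'cV[R]_p) (UD : 'M[R]_(p + 1) * 'M[R]_(N, p + 1)) : R :=
  let X := xbar x *m (xbar x)^T in
  \tr (UD.1 *m X) + \tr ((H^T *m UD.2 + UD.2^T *m H) *m X)
  + \tr (H^T *m H *m X).

(* Main.v *)
(** Put [y = xbar x], [a = H y] and [c = \sum_i sqrt (rho_i) |y_i|]; both optimal
    values equal [(|a| + c)^2].  The SDP is a relaxation: a robust-feasible [Delta]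
    lifts to [U = Delta^T Delta + diag (rho_i - |Delta_i|^2)].  Conversely, the
    2x2 minors of [U] give [|U_ij| <= sqrt (rho_i rho_j)], hence
    [y^T U y <= c^2], and testing the block matrix on [(y, -(c / |a|) a)] bounds
    the cross term [2 a^T Delta y] by [2 c |a|].  The bound is reached by
    [Delta_i = sqrt (rho_i) sgn (y_i) e] for a unit vector [e] along [a]. *)
Require Import Defs.
From mathcomp Require Import all_boot all_order all_algebra.
From mathcomp Require Import ring lra.
From mathcomp Require Import classical_sets reals.

Set Implicit Arguments.
Unset Strict Implicit.
Unset Printing Implicit Defensive.

Import Order.TTheory GRing.Theory Num.Theory.

Local Open Scope ring_scope.

(** * Euclidean inner product *)

Definition dot (R : realType) (n : nat) (u v : 'cV[R]_n) : R :=
  (u^T *m v) 0 0.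

Section Dot.
Variables (R : realType) (n : nat).
Implicit Types (u v w : 'cV[R]_n) (k : R).

Lemma dotE u v : dot u v = \sum_i u i 0 * v i 0.
Proof. by rewrite /dot mxE; apply: eq_bigr => i _; rewrite mxE. Qed.

Lemma dotC u v : dot u v = dot v u.
Proof. by rewrite !dotE; apply: eq_bigr => i _; rewrite mulrC. Qed.

Lemma dotDl u v w : dot (u + v) w = dot u w + dot v w.
Proof. by rewrite /dot linearD mulmxDl mxE. Qed.

Lemma dotDr u v w : dot w (u + v) = dot w u + dot w v.
Proof. by rewrite /dot mulmxDr mxE. Qed.

Lemma dotZl k u v : dot (k *: u) v = k * dot u v.
Proof. by rewrite /dot linearZ -scalemxAl mxE. Qed.

Lemma dotZr k u v : dot u (k *: v) = k * dot u v.
Proof. by rewrite /dot -scalemxAr mxE. Qed.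

Lemma dot_ge0 u : 0 <= dot u u.
Proof. by rewrite dotE sumr_ge0 // => i _; rewrite -expr2 sqr_ge0. Qed.

Lemma norm2_ge0 u : 0 <= norm2 u.
Proof. exact: sqrtr_ge0. Qed.

Lemma norm2_sqr u : norm2 u ^+ 2 = dot u u.
Proof.
rewrite /norm2 sqr_sqrtr; last by rewrite sumr_ge0 // => i _; rewrite sqr_ge0.
by rewrite dotE; apply: eq_bigr => i _; rewrite expr2.
Qed.

Lemma norm2_eq0 u : norm2 u = 0 -> u = 0.
Proof.
move=> u0; apply/colP => i; rewrite mxE; apply/eqP; rewrite -sqrf_eq0.
have : dot u u == 0 by rewrite -norm2_sqr u0 expr0n.
rewrite dotE psumr_eq0; last by move=> j _; rewrite -expr2 sqr_ge0.
by move=> /allP /(_ i); rewrite mem_index_enum -expr2 => /(_ isT).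
Qed.

(** For [u = 0] any unit vector serves; a basis vector is taken, hence the positive dimension. *)
Lemma exists_direction (hn : (0 < n)%N) u :
  exists e, dot e e = 1 /\ u = norm2 u *: e.
Proof.
have [u0|u_neq0] := eqVneq (norm2 u) 0.
  exists (delta_mx (Ordinal hn) 0); split; last by rewrite u0 scale0r; exact: norm2_eq0.
  by rewrite /dot trmx_delta mul_delta_mx mxE eqxx.
exists ((norm2 u)^-1 *: u); split; last by rewrite scalerA divff ?scale1r.
by rewrite dotZl dotZr -norm2_sqr; field.
Qed.

End Dot.

Lemma dot_mulmx (R : realType) (m n : nat) (A : 'M[R]_(m, n)) u v :
  dot (A *m u) v = dot u (A^T *m v).
Proof. by rewrite /dot trmx_mul mulmxA. Qed.

Lemma dot_delta (R : realType) (n : nat) (A : 'M[R]_n) i j :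
  dot (delta_mx i 0) (A *m delta_mx j 0) = A i j.
Proof. by rewrite /dot trmx_delta -rowE -colE !mxE. Qed.

Lemma symmetricmxE (R : realType) (n : nat) (A : 'M[R]_n) :
  (A \is symmetricmx) = (A == A^T).
Proof. by rewrite is_hermitianmxE expr0 scale1r map_mx_id. Qed.

(** * Quadratic forms and positive semidefinite block matrices *)

Lemma mxtrace_mul_rank1 (R : realType) (n : nat) (A : 'M[R]_n) (y : 'cV[R]_n) :
  \tr (A *m (y *m y^T)) = dot y (A *m y).
Proof. by rewrite mulmxA mxtrace_mulC trace_mx11. Qed.

Lemma quad_form_block (R : realType) (N n : nat) (U : 'M[R]_n)
    (D : 'M[R]_(N, n)) (u : 'cV[R]_n) (w : 'cV[R]_N) :
  ((col_mx u w)^T *m block_mx U D^T D 1%:M *m col_mx u w) 0 0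
  = dot u (U *m u) + 2 * dot w (D *m u) + dot w w.
Proof.
rewrite -mulmxA mul_block_col tr_col_mx mul_row_col mxE mul1mx.
rewrite -[LHS]/(dot u (U *m u + D^T *m w) + dot w (D *m u + w)).
rewrite !dotDr -dot_mulmx (dotC (D *m u)); ring.
Qed.

Lemma psd_blockP (R : realType) (N n : nat) (U : 'M[R]_n) (D : 'M[R]_(N, n)) :
  U \is symmetricmx ->
  psd (block_mx U D^T D 1%:M) <->
  forall u w, 0 <= dot u (U *m u) + 2 * dot w (D *m u) + dot w w.
Proof.
move=> Usym; split=> [[_ psdB] u w|psdB].
  by rewrite -quad_form_block.
split=> [|v]; last by rewrite -[v]vsubmxK quad_form_block.
by move: Usym; rewrite !symmetricmxE tr_block_mx trmxK trmx1 => /eqP <-.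
Qed.

(** At [r_j e_i - s r_i e_j] the form equals [2 r_i r_j (r_i r_j - s U_ij)]. The signs [s = 1] and
    [s = -1] together bound [|U_ij|]. *)
Lemma psd_entry_le (R : realType) (n : nat) (U : 'M[R]_n) (r : 'I_n -> R) i j s :
  U \is symmetricmx -> (forall u, 0 <= dot u (U *m u)) ->
  (forall k, 0 < r k) -> (forall k, U k k = r k ^+ 2) ->
  s ^+ 2 = 1 -> s * U i j <= r i * r j.
Proof.
move=> Usym Upsd r_gt0 Ud s2.
have Uji : U j i = U i j.
  by move: Usym; rewrite symmetricmxE => /eqP {1}->; rewrite mxE.
have := Upsd (r j *: delta_mx i 0 - (s * r i) *: delta_mx j 0).
rewrite -scaleNr mulmxDr -!scalemxAr !(dotDl, dotDr, dotZl, dotZr) !dot_delta.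
rewrite Uji !Ud => h.
have : 0 <= (r i * r j) * (r i * r j - s * U i j).
  have e : s * s = 1 by rewrite -expr2.
  have {}h : 0 <= r i ^+ 2 * r j ^+ 2 * (1 + s * s) - 2 * (s * r i * r j * U i j).
    by apply: le_trans h _; rewrite le_eqVlt; apply/orP; left; apply/eqP; ring.
  rewrite e in h; lra.
by rewrite pmulr_rge0 ?mulr_gt0 // subr_ge0.
Qed.

(** Both sides expand into double sums over [(i, j)], which are compared term by term. *)
Lemma psd_quad_le (R : realType) (n : nat) (U : 'M[R]_n) (r : 'I_n -> R)
    (y : 'cV[R]_n) :
  U \is symmetricmx -> (forall u, 0 <= dot u (U *m u)) ->
  (forall k, 0 < r k) -> (forall k, U k k = r k ^+ 2) ->
  dot y (U *m y) <= (\sum_i r i * `|y i 0|) ^+ 2.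
Proof.
move=> Usym Upsd r_gt0 Ud.
rewrite dotE expr2 mulr_suml; apply: ler_sum => i _.
rewrite mxE !mulr_sumr; apply: ler_sum => j _.
have abs_le : `|U i j| <= r i * r j.
  rewrite ler_norml -[- _ <= _]lerNl.
  have := psd_entry_le i j Usym Upsd r_gt0 Ud (expr1n R 2).
  have := @psd_entry_le _ _ _ _ i j (-1) Usym Upsd r_gt0 Ud.
  by rewrite sqrrN expr1n mulN1r mul1r => /(_ erefl) -> ->.
apply: le_trans (ler_norm _) _; rewrite !normrM.
have -> : r i * `|y i 0| * (r j * `|y j 0|)
  = `|y i 0| * ((r i * r j) * `|y j 0|) by ring.
by rewrite ler_wpM2l // ler_wpM2r.
Qed.

Lemma quad_gram (R : realType) (m n : nat) (D : 'M[R]_(m, n)) u :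
  dot u (D^T *m D *m u) = dot (D *m u) (D *m u).
Proof. by rewrite dot_mulmx mulmxA. Qed.

Lemma quad_diag (R : realType) (n : nat) (d : 'rV[R]_n) u :
  dot u (diag_mx d *m u) = \sum_i d 0 i * u i 0 ^+ 2.
Proof. by rewrite dotE; apply: eq_bigr => i _; rewrite mul_diag_mx mxE; ring. Qed.

(** * The common optimal value of the two problems *)

Section Duality.
Variables (R : realType) (N p : nat) (rho : 'I_(p + 1) -> R).
Hypothesis rho_gt0 : forall i, 0 < rho i.
Variables (H : 'M[R]_(N, p + 1)) (x : 'cV[R]_p).
Implicit Types (D : 'M[R]_(N, p + 1)) (U : 'M[R]_(p + 1)).

Let y := xbar x.
Let a := H *m y.
Let c := \sum_i Num.sqrt (rho i) * `|y i 0|.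

Lemma rob_objectiveE D :
  rob_objective H x D
  = dot (D *m y) (D *m y) + 2 * dot a (D *m y) + dot a a.
Proof.
rewrite /rob_objective norm2_sqr mulmxDl -/y -/a !(dotDl, dotDr).
rewrite (dotC (D *m y) a); ring.
Qed.

Lemma sdp_objectiveE U D :
  sdp_objective H x (U, D)
  = dot y (U *m y) + 2 * dot a (D *m y) + dot a a.
Proof.
rewrite /sdp_objective /= !mxtrace_mul_rank1 quad_gram mulmxDl dotDr -!mulmxA.
rewrite -!dot_mulmx -/y -/a (dotC (D *m y) a); ring.
Qed.

(** The last coordinate of [y] is -1, so its term alone is positive. Strictness allows cancelling
    [c] in the cross-term bound. *)
Lemma weighted_l1_gt0 : 0 < c.
Proof.
rewrite /c (bigD1 (rshift p ord0)) //= ltr_pwDl //.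
  rewrite mulr_gt0 ?sqrtr_gt0 //.
  by rewrite /y /xbar col_mxEd mxE normrN normr1.
by rewrite sumr_ge0 // => i _; rewrite mulr_ge0 ?sqrtr_ge0.
Qed.

Lemma sdp_objective_le U D :
  sdp_feasible rho (U, D) -> sdp_objective H x (U, D) <= (norm2 a + c) ^+ 2.
Proof.
case=> /= Usym Udiag /(psd_blockP _ Usym) psdB.
have c_gt0 := weighted_l1_gt0.
have quad_le : dot y (U *m y) <= c ^+ 2.
  apply: psd_quad_le => // [u|k|k].
  - have := psdB u 0.
    by rewrite [dot 0 _]dotC -(scale0r 0) !(dotZl, dotZr) !mul0r mulr0 !addr0.
  - by rewrite sqrtr_gt0.
  - by rewrite Udiag sqr_sqrtr // ltW.
rewrite sdp_objectiveE -norm2_sqr.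
(* The test vector below divides by [|a|]; for [a = 0] the cross term vanishes. *)
have [a0|a_neq0] := eqVneq (norm2 a) 0.
  rewrite a0 (norm2_eq0 a0) -(scale0r 0) dotZl; lra.
have a_gt0 : 0 < norm2 a by rewrite lt_def a_neq0 norm2_ge0.
(* At an optimal [D] one has [D y = (c / |a|) a], and the block form vanishes at [(y, - D y)]: this
   test is tight. *)
have := psdB y (- (c / norm2 a) *: a).
rewrite !(dotZl, dotZr) -norm2_sqr.
set t := dot a _; set q := dot y _; set A := norm2 a => h.
have {}h : 2 * c * t <= A * q + A * c ^+ 2.
  have : 0 <= A * (q + 2 * (- (c / A) * t)
                   + - (c / A) * (- (c / A) * A ^+ 2)) by rewrite pmulr_rge0.
  have -> : A * (q + 2 * (- (c / A) * t)
                   + - (c / A) * (- (c / A) * A ^+ 2))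
    = A * q - 2 * c * t + A * c ^+ 2 by field.
  lra.
(* From [2 c t <= A q + A c^2] and [q <= c^2], after cancelling [2 c]. *)
have cross_le : t <= c * A.
  rewrite -(ler_pM2l c_gt0).
  have : A * q <= A * c ^+ 2 by rewrite ler_pM2l.
  lra.
have : q <= c ^+ 2 by [].
lra.
Qed.

(** The diagonal slack, nonnegative for feasible [D], turns the column inequalities into the
    equalities [U_ii = rho_i]. *)
Definition sdp_lift D : 'M[R]_(p + 1) :=
  D^T *m D + diag_mx (\row_i (rho i - norm2 (col i D) ^+ 2)).

Lemma quad_sdp_lift D u :
  rob_feasible rho D -> dot (D *m u) (D *m u) <= dot u (sdp_lift D *m u).
Proof.
move=> feasD; rewrite mulmxDl dotDr quad_gram quad_diag lerDl.
by rewrite sumr_ge0 // => i _; rewrite mxE mulr_ge0 ?sqr_ge0 // subr_ge0.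
Qed.

(** The block form at [(u, w)] is [|D u + w|^2] plus the nonnegative slack form at [u]. *)
Lemma sdp_lift_feasible D :
  rob_feasible rho D -> sdp_feasible rho (sdp_lift D, D).
Proof.
move=> feasD.
have liftsym : sdp_lift D \is symmetricmx.
  by rewrite symmetricmxE linearD /= trmx_mul trmxK tr_diag_mx.
split=> //= [i|].
  rewrite mxE [diag_mx _ i i]mxE eqxx mulr1n [in X in _ + X]mxE norm2_sqr.
  suff -> : (D^T *m D) i i = dot (col i D) (col i D) by ring.
  by rewrite dotE mxE; apply: eq_bigr => k _; rewrite !mxE.
apply/psd_blockP => // u w.
have := dot_ge0 (D *m u + w); have := quad_sdp_lift u feasD.
rewrite !(dotDl, dotDr) (dotC (D *m u) w); lra.
Qed.

Lemma rob_objective_le_lift D :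
  rob_feasible rho D -> rob_objective H x D <= sdp_objective H x (sdp_lift D, D).
Proof.
by move=> feasD; rewrite rob_objectiveE sdp_objectiveE !lerD2r quad_sdp_lift.
Qed.

Lemma rob_objective_attained : (0 < N)%N ->
  exists2 D, rob_feasible rho D & rob_objective H x D = (norm2 a + c) ^+ 2.
Proof.
move=> hN; have [e [e1 aE]] := exists_direction hN a.
pose s : 'rV[R]_(p + 1) := \row_i (Num.sqrt (rho i) * Num.sg (y i 0)).
exists (e *m s) => [i|].
  have -> : col i (e *m s) = s 0 i *: e.
    by apply/colP => k; rewrite mxE [LHS]mxE big_ord1 [RHS]mxE mulrC.
  rewrite norm2_sqr dotZl dotZr e1 mxE mulr1 -expr2 exprMn sqr_sg.
  (* The squared sign is 0 or 1: column [i] vanishes when [y_i = 0], and otherwise its constraint is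
     tight. *)
  by rewrite sqr_sqrtr ?ler_piMr ?lern1 ?leq_b1 // ltW.
(* Since [sg (y_i) y_i = |y_i|], the perturbation sends [y] to [c e], aligned with [a = |a| e]. *)
have sy : s *m y = c%:M.
  apply/rowP => k; rewrite ord1 !mxE eqxx mulr1n; apply: eq_bigr => i _.
  by rewrite mxE normrEsg mulrA.
rewrite /rob_objective norm2_sqr mulmxDl -/y -/a -mulmxA sy mul_mx_scalar.
by rewrite {1 2}aE -scalerDl dotZl dotZr e1 mulr1 expr2.
Qed.

End Duality.

Theorem theorem8 (R : realType) (N p : nat) (hN : (0 < N)%N)
    (rho : 'I_(p + 1) -> R) (hrho : forall i, 0 < rho i) :
  forall (H : 'M[R]_(N, p + 1)) (x : 'cV[R]_p),
  exists v : R,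
    is_max_value (@rob_feasible R N p rho) (rob_objective H x) v /\
    is_max_value (@sdp_feasible R N p rho) (sdp_objective H x) v.
Proof.
move=> H x; have [D feasD DE] := rob_objective_attained hrho H x hN.
set v := (X in _ = X) in DE.
have sdp_ub UD : sdp_feasible rho UD -> sdp_objective H x UD <= v.
  by case: UD => U D'; exact: (sdp_objective_le hrho).
exists v; split; split.
- by exists D.
- move=> _ [D' feasD' <-].
  (* The SDP bound carries over to the robust problem through the lift. *)
  apply: le_trans (rob_objective_le_lift H x feasD') (sdp_ub _ _).
  exact: sdp_lift_feasible.
(* The lift of a robust optimum has SDP value at least [v], and at most [v] by [sdp_ub]. *)
- exists (sdp_lift rho D, D); first exact: sdp_lift_feasible.
  by apply/eqP; rewrite eq_le sdp_ub -?DE ?rob_objective_le_lift //;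
    exact: sdp_lift_feasible.
- by move=> _ [UD feasUD <-]; exact: sdp_ub.
Qed.
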